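(* Let $\mathcal{K}_1$ and $\mathcal{K}_2$ be consistent $\mathcal{ALC}$ KBs, $\Sigma$ a signature, and for $i=1,2$ let $\boldsymbol{M}_i$ be a set of models that is complete for $\mathcal{K}_i$. Then: (1) $\mathcal{K}_1$ $\Sigma$-UCQ entails $\mathcal{K}_2$ iff for every $n>0$ and every $\mathcal{I}_1\in\boldsymbol{M}_1$ there exists $\mathcal{I}_2\in\boldsymbol{M}_2$ that is $n\Sigma$-homomorphically embeddable into $\mathcal{I}_1$; (2) $\mathcal{K}_1$ $\Sigma$-rUCQ entails $\mathcal{K}_2$ iff for every $n>0$ and every $\mathcal{I}_1\in\boldsymbol{M}_1$ there exists $\mathcal{I}_2\in\boldsymbol{M}_2$ that is con-$n\Sigma$-homomorphically embeddable into $\mathcal{I}_1$; (3) $\mathcal{K}_1$ $\Sigma$-CQ entails $\mathcal{K}_2$ iff $\prod\boldsymbol{M}_2$ is $n\Sigma$-homomorphically embeddable into $\prod\boldsymbol{M}_1$ for every $n>0$; (4) $\mathcal{K}_1$ $\Sigma$-rCQ entails $\mathcal{K}_2$ iff $\prod\boldsymbol{M}_2$ is con-$n\Sigma$-homomorphically embeddable into $\prod\boldsymbol{M}_1$ for every $n>0$.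
   Context: $\mathcal{ALC}$ concepts are built from concept names and $\top$ using $\neg$, $\sqcap$, $\exists R.C$; a TBox is a finite set of inclusions $C\sqsubseteq D$; an ABox is a finite set of assertions $A(a)$, $R(a,b)$; a KB is $\mathcal{K}=(\mathcal{T},\mathcal{A})$ with $\mathsf{ind}(\mathcal{K})$ its set of individuals. Interpretations satisfy $a^{\mathcal{I}}=a$. CQs $q(\vec x)=\exists\vec y\,\varphi$ are conjunctions of atoms $A(z)$, $R(z,z')$; a CQ is rooted (rCQ) if each quantified variable is connected (via atoms $R(u,v)$, ignoring direction) to an answer variable; UCQs are disjunctions of CQs with the same answer variables, rUCQs those whose disjuncts are all rooted. $\mathcal{K}\models q(\vec a)$ means every model of $\mathcal{K}$ satisfies $q(\vec a)$. A $\Sigma$-query uses only concept and role names from the signature $\Sigma$. For consistent KBs and $\mathcal{Q}\in\{$CQ, rCQ, UCQ, rUCQ$\}$, $\mathcal{K}_1$ $\Sigma$-$\mathcal{Q}$ entails $\mathcal{K}_2$ if for every $\Sigma$-query $q(\vec x)$ in $\mathcal{Q}$ and tuple $\vec a$ from $\mathsf{ind}(\mathcal{K}_2)$, $\mathcal{K}_2\models q(\vec a)$ implies $\vec a\subseteq\mathsf{ind}(\mathcal{K}_1)$ and $\mathcal{K}_1\models q(\vec a)$. A set $\boldsymbol{M}$ of models of $\mathcal{K}$ is complete for $\mathcal{K}$ if for every UCQ $q(\vec x)$ and tuple $\vec a$: $\mathcal{K}\models q(\vec a)$ iff $\mathcal{I}\models q(\vec a)$ for all $\mathcal{I}\in\boldsymbol{M}$.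 The product $\prod\boldsymbol{M}$ of a set of interpretations is the usual direct product: its domain is the Cartesian product of the domains, a concept name is interpreted as the set of tuples all of whose components lie in the respective extensions, a role name as the set of pairs of tuples related componentwise, and each individual name $a$ is (identified with) the tuple all of whose components are $a$. For interpretations $\mathcal{I}_2$ (of $\mathcal{K}_2$) and $\mathcal{I}_1$ (of $\mathcal{K}_1$), a map $h:\Delta^{\mathcal{I}_2}\to\Delta^{\mathcal{I}_1}$ is a $\Sigma$-homomorphism if $u\in A^{\mathcal{I}_2}$ implies $h(u)\in A^{\mathcal{I}_1}$ and $(u,v)\in R^{\mathcal{I}_2}$ implies $(h(u),h(v))\in R^{\mathcal{I}_1}$ for all $\Sigma$-concept names $A$ and $\Sigma$-role names $R$, and $h(a)=a$ for all $a\in\mathsf{ind}(\mathcal{K}_2)$ (in its domain). $\mathcal{I}_2$ is $n\Sigma$-homomorphically embeddable into $\mathcal{I}_1$ if every subinterpretation $\mathcal{I}_2'$ of $\mathcal{I}_2$ with $|\Delta^{\mathcal{I}_2'}|\le n$ admits a $\Sigma$-homomorphism into $\mathcal{I}_1$; it is con-$n\Sigma$-homomorphically embeddable if this holds for all such subinterpretations that are moreover $\Sigma$-connected, i.e. every element $u$ of the subinterpretation not in $\mathsf{ind}(\mathcal{K}_2)$ is reachable from some individual $a$ by a path $(a,u_1)\in R_1,\dots,(u_n,u)\in R_n$ with all $R_i\in\Sigma$.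
   Formalization: In (4), Σ-connectedness uses paths that ignore role direction, as in rooted CQs, since with directed paths (4) is false; and the signature Σ is taken to be finite, since (1) fails for infinite Σ. *)

(* Defs.v *)
From Stdlib Require List.
From Stdlib Require Export Relation_Operators.
From mathcomp Require Export all_boot.
From mathcomp Require Export boolp classical_sets functions cardinality.

Set Implicit Arguments.
Unset Strict Implicit.
Unset Printing Implicit Defensive.

Local Open Scope classical_set_scope.
Local Open Scope card_scope.

Definition cname := nat.
Definition rname := nat.
Definition iname := nat.

Inductive concept :=
  | Top
  | CName of cname
  | Not of concept
  | And of concept & concept
  | Ex of rname & concept.

(* [(C, D)] in [tbox] is the inclusion of C in D; [(A, a)] in [cabox] and
   [(R, a, b)] in [rabox] are the assertions A(a) and R(a,b). *)
Record kb := KB {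
  tbox : seq (concept * concept);
  cabox : seq (cname * iname);
  rabox : seq (rname * iname * iname)
}.

Definition ind (K : kb) : seq iname :=
  [seq p.2 | p <- cabox K]
    ++ [seq p.1.2 | p <- rabox K] ++ [seq p.2 | p <- rabox K].

(* [named I a u] reads "u is the individual a". A relation rather than a
   function from names to elements, so that subinterpretations may miss
   individuals and an interpretation of K names the members of ind(K) only. *)
Record interp := Interp {
  dom : Type;
  named : iname -> set dom;
  cext : cname -> set dom;
  rext : rname -> dom -> set dom
}.

Arguments named : clear implicits.
Arguments cext : clear implicits.
Arguments rext : clear implicits.

Fixpoint ceval (I : interp) (C : concept) : set (dom I) :=
  match C with
  | Top => setT
  | CName A => cext I A
  | Not C => ~` ceval C
  | And C D => ceval C `&` ceval D
  | Ex R C => [set u | exists2 v, rext I R u v & ceval C v]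
  end.

Arguments ceval : clear implicits.

(* The standard name assumption: every a in N is an element of the domain,
   distinct names are distinct elements, and no other individual name is an
   element. *)
Definition interp_of (N : seq iname) (I : interp) : Prop :=
  [/\ [set: dom I] !=set0,
      forall a, a \in N -> exists! u, named I a u,
      forall a u, named I a u -> a \in N
    & forall a b u, named I a u -> named I b u -> a = b].

Definition model (K : kb) (I : interp) : Prop :=
  [/\ interp_of (ind K) I,
      forall C D, List.In (C, D) (tbox K) -> ceval I C `<=` ceval I D,
      forall A a u, (A, a) \in cabox K -> named I a u -> cext I A u
    & forall R a b u v, (R, a, b) \in rabox K ->
        named I a u -> named I b v -> rext I R u v].

Definition consistent (K : kb) : Prop := exists I, model K I.

(* A CQ with answer variables [inl i], i : 'I_k, and quantified variables
   [inr j], j : 'I_qvars. Answer variables need not occur in an atom. *)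
Record cq (k : nat) := CQ {
  qvars : nat;
  catoms : seq (cname * ('I_k + 'I_qvars));
  ratoms : seq (rname * ('I_k + 'I_qvars) * ('I_k + 'I_qvars))
}.

(* Only the nonempty sequences are UCQs; see [UCQ]. *)
Definition ucq (k : nat) := seq (cq k).

Definition cq_sat (I : interp) k (q : cq k) (a : 'I_k -> iname) : Prop :=
  exists s : 'I_k + 'I_(qvars q) -> dom I,
    [/\ forall i, named I (a i) (s (inl i)),
        forall A t, (A, t) \in catoms q -> cext I A (s t)
      & forall R t t', (R, t, t') \in ratoms q -> rext I R (s t) (s t')].

Definition ucq_sat (I : interp) k (q : ucq k) (a : 'I_k -> iname) : Prop :=
  exists2 p, List.In p q & cq_sat I p a.

Definition kb_entails (K : kb) k (q : ucq k) (a : 'I_k -> iname) : Prop :=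
  forall I, model K I -> ucq_sat I q a.

Definition rooted k (q : cq k) : Prop :=
  forall j : 'I_(qvars q), exists i : 'I_k,
    clos_refl_sym_trans _ (fun t t' => exists R, (R, t, t') \in ratoms q)
      (inl i) (inr j).

Definition query_class := forall k, ucq k -> Prop.

Definition UCQ : query_class := fun k q => (0 < size q)%N.
Definition rUCQ : query_class :=
  fun k q => UCQ q /\ forall p, List.In p q -> rooted p.
Definition CQs : query_class := fun k q => size q = 1%N.
Definition rCQs : query_class :=
  fun k q => CQs q /\ forall p, List.In p q -> rooted p.

Record signature := Signature { scn : seq cname; srn : seq rname }.

Definition sig_query (Sg : signature) k (q : ucq k) : Prop :=
  forall p, List.In p q ->
    (forall A t, (A, t) \in catoms p -> A \in scn Sg) /\
    (forall R t t', (R, t, t') \in ratoms p -> R \in srn Sg).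

Definition sig_entails (Sg : signature) (Q : query_class) (K1 K2 : kb) : Prop :=
  forall k (q : ucq k) (a : 'I_k -> iname),
    Q k q -> sig_query Sg q -> (forall i, a i \in ind K2) ->
    kb_entails K2 q a ->
    (forall i, a i \in ind K1) /\ kb_entails K1 q a.

(* A set of interpretations is a family [M : J -> interp] over a type J. *)
Definition complete (K : kb) (J : Type) (M : J -> interp) : Prop :=
  (forall j, model K (M j)) /\
  forall k (q : ucq k) (a : 'I_k -> iname),
    UCQ q -> (forall i, a i \in ind K) ->
    (kb_entails K q a <-> forall j, ucq_sat (M j) q a).

Definition prod_interp (J : Type) (M : J -> interp) : interp := {|
  dom := forall j, dom (M j);
  named := fun a => [set f | forall j, named (M j) a (f j)];
  cext := fun A => [set f | forall j, cext (M j) A (f j)];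
  rext := fun R f => [set g | forall j, rext (M j) R (f j) (g j)]
|}.

Definition sub_interp (I : interp) (S : set (dom I)) : interp := {|
  dom := {u : dom I | S u};
  named := fun a => [set u | named I a (proj1_sig u)];
  cext := fun A => [set u | cext I A (proj1_sig u)];
  rext := fun R u => [set v | rext I R (proj1_sig u) (proj1_sig v)]
|}.

Definition sig_hom (Sg : signature) (N : seq iname) (I2 I1 : interp)
    (h : dom I2 -> dom I1) : Prop :=
  [/\ forall A u, A \in scn Sg -> cext I2 A u -> cext I1 A (h u),
      forall R u v, R \in srn Sg -> rext I2 R u v -> rext I1 R (h u) (h v)
    & forall a u, a \in N -> named I2 a u -> named I1 a (h u)].

Definition sig_step (Sg : signature) (I : interp) (u v : dom I) : Prop :=
  exists2 R, R \in srn Sg & rext I R u v.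

Definition sig_link (Sg : signature) (I : interp) (u v : dom I) : Prop :=
  sig_step Sg u v \/ sig_step Sg v u.

Definition connected_by (N : seq iname) (I : interp)
    (step : dom I -> dom I -> Prop) : Prop :=
  forall u, (forall a, a \in N -> ~ named I a u) ->
    exists a v, [/\ a \in N, named I a v & clos_trans _ step v u].

Definition sig_connected (Sg : signature) (N : seq iname) (I : interp) : Prop :=
  connected_by N (@sig_step Sg I).

(* The variant of [sig_connected] in which paths ignore the direction of the
   roles, as in [rooted]. Products need it: let both ABoxes be
   {R(a,c), R(b,c), D(a,b)}, T1 empty, T2 = {not A and Ex D (not A) <= not Top},
   Sg = {A, R}, M1 the ABox as a model, M2 its two extensions with A = {a} and
   with A = {b}. K2 entails the rooted CQ Ex y z, R(x,y), R(z,y), A(z) at x = a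
   and K1 does not, but the only witness (a,b) for z in the product of M2 has no
   incoming edge, and the elements reachable from individuals along directed
   paths are a, b, c, none of which is in A. *)
Definition sig_linked (Sg : signature) (N : seq iname) (I : interp) : Prop :=
  connected_by N (@sig_link Sg I).

Definition embeddable (n : nat) (Sg : signature) (N : seq iname)
    (I2 I1 : interp) : Prop :=
  forall S : set (dom I2), S #<= `I_n ->
    exists h : dom (sub_interp S) -> dom I1, sig_hom Sg N h.

Definition con_embeddable (n : nat) (Sg : signature) (N : seq iname)
    (I2 I1 : interp) : Prop :=
  forall S : set (dom I2), S #<= `I_n -> sig_connected Sg N (sub_interp S) ->
    exists h : dom (sub_interp S) -> dom I1, sig_hom Sg N h.

Definition link_embeddable (n : nat) (Sg : signature) (N : seq iname)
    (I2 I1 : interp) : Prop :=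
  forall S : set (dom I2), S #<= `I_n -> sig_linked Sg N (sub_interp S) ->
    exists h : dom (sub_interp S) -> dom I1, sig_hom Sg N h.

(* Main.v *)
(** A set S of at most n elements of an interpretation is turned into a canonical
    query: its answer variables are all individuals of K2, its quantified
    variables are the unnamed elements of S, its atoms are the Sg-facts. A match
    of it in I1 is exactly a homomorphism from S, extended to the individuals,
    into I1, and up to renaming only finitely many canonical queries exist for
    given n. Hence entailment gives embeddings: for UCQs one takes the
    disjunction of the canonical queries that fail in I1, for CQs a single
    canonical query of the product, which a product satisfies iff all its factors
    do. Conversely a match of a query of size at most n, composed with an
    embedding of its image, is a match in I1. For rUCQs the image must be
    connected by directed paths; a match in the forest unravelling has this
    property, and projects to a match in the original model. *)

Require Import Defs.

Set Implicit Arguments.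
Unset Strict Implicit.
Unset Printing Implicit Defensive.

Local Open Scope classical_set_scope.
Local Open Scope card_scope.

(** * Finite sets and finite families of queries *)

Lemma card_leI_enum (T : Type) (P : set T) n : P #<= `I_n ->
  exists m (e : 'I_m -> T), (m <= n)%N /\ forall u, P u <-> exists j, e j = u.
Proof.
move=> /pcard_leP[f].
pose X := [set i : 'I_n | `[< exists u, P u /\ f u = i >]]%SET.
have gP (j : 'I_#|X|) : exists u, P u /\ f u = enum_val j.
  by have := enum_valP j; rewrite inE => /asboolP.
have [g gE] := choice gP.
exists #|X|, g; split; first by rewrite -[n in (_ <= n)%N]card_ord max_card.
move=> u; split=> [Pu|[j <-]]; last by case: (gE j).
have fun_lt : (f u < n)%N by apply: (@funS _ _ _ _ f).
have uX : Ordinal fun_lt \in X by rewrite inE; apply/asboolP; exists u.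
exists (enum_rank_in uX (Ordinal fun_lt)).
have [Pg fg] := gE (enum_rank_in uX (Ordinal fun_lt)).
rewrite enum_rankK_in // in fg.
by apply: (@inj _ _ _ f); rewrite ?inE.
Qed.

Lemma card_range_leI (X : finType) (T : Type) (s : X -> T) n :
  (#|X| <= n)%N -> range s #<= `I_n.
Proof.
move=> Xn; apply: card_le_trans (card_image_le s setT) _.
pose f (x : X) : nat := enum_rank x.
have finj : {in [set: X] &, injective f}.
  by move=> x y _ _ /val_inj /enum_rank_inj.
have := inj_card_eq finj; rewrite card_eq_le => /andP[_ /card_le_trans]; apply.
by apply: subset_card_le => _ [x _ <-] /=; exact: leq_trans (ltn_ord _) Xn.
Qed.

(** [LL] lists the subsequences of [l]. As [T] has no decidable equality, the first clause says
    through predicates that their entries come from [l]. *)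
Lemma filter_family (T : Type) (l : seq T) :
  exists LL : seq (seq T), (forall l', List.In l' LL ->
      forall P : pred T, all P l -> all P l') /\
    forall P : pred T, List.In (filter P l) LL.
Proof.
elim: l => [|x l [LL [LLsub LLall]]].
  by exists [:: [::]]; split=> [l' [<-|//]|P]; last left.
exists (LL ++ map (cons x) LL); split=> [l' /List.in_app_iff[lLL|]|P] /=.
- by move=> P /andP[_]; apply: LLsub.
- move=> /List.in_map_iff[l'' [<- lLL]] P /= /andP[-> /=].
  exact: LLsub.
apply/List.in_app_iff; case: (P x); [right|left=> //].
by apply/List.in_map_iff; exists (filter P l).
Qed.

(** With at most [n] quantified variables there are only finitely many [Sg]-atoms, and every set of
    them is cut out of the full list by a filter. *)
Lemma sig_cq_family (Sg : signature) (k n : nat) :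
  exists L : seq (cq k), sig_query Sg L /\
    forall m (C : cname -> 'I_k + 'I_m -> Prop)
      (D : rname -> 'I_k + 'I_m -> 'I_k + 'I_m -> Prop), (m <= n)%N ->
    exists2 p : cq k, List.In p L &
      exists ca ra, [/\ p = @CQ k m ca ra,
        forall A t, (A, t) \in ca <-> A \in scn Sg /\ C A t
      & forall R t t', (R, t, t') \in ra <-> R \in srn Sg /\ D R t t'].
Proof.
have step m : exists L : seq (cq k), sig_query Sg L /\
    forall (C : cname -> 'I_k + 'I_m -> Prop)
      (D : rname -> 'I_k + 'I_m -> 'I_k + 'I_m -> Prop),
    exists2 p : cq k, List.In p L &
      exists ca ra, [/\ p = @CQ k m ca ra,
        forall A t, (A, t) \in ca <-> A \in scn Sg /\ C A t
      & forall R t t', (R, t, t') \in ra <-> R \in srn Sg /\ D R t t'].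
  pose V := ('I_k + 'I_m)%type.
  pose l1 := [seq (A, t) | A <- scn Sg, t <- enum {: V}].
  pose l2 := [seq (Rt, t') | Rt <- [seq (R, t) | R <- srn Sg, t <- enum {: V}],
                             t' <- enum {: V}].
  have l1E A t : ((A, t) \in l1) = (A \in scn Sg).
    apply/allpairsP/idP => [[[A' t'] /= [h _ [-> _]]] //|h].
    by exists (A, t); rewrite mem_enum.
  have l2E R t t' : ((R, t, t') \in l2) = (R \in srn Sg).
    apply/allpairsP/idP => [[[[R' t1] t2] /= [h _ [-> _ _]]]|h].
      by have /allpairsP[[R'' t3] /= [h' _ [-> _]]] := h.
    exists ((R, t), t'); rewrite mem_enum; split=> //=.
    by apply/allpairsP; exists (R, t); rewrite mem_enum.
  have [L1 [sub1 all1]] := filter_family l1.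
  have [L2 [sub2 all2]] := filter_family l2.
  exists (List.flat_map (fun ca => List.map (fun ra => @CQ k m ca ra) L2) L1).
  split=> [p|C D].
    move=> /List.in_flat_map[ca [caL1]] /List.in_map_iff[ra [<- raL2]] /=.
    split=> [A t Aca|R t t' Rra].
      have /allP/(_ _ Aca) : all (fun x => x \in l1) ca.
        by apply: sub1 => //; apply/allP.
      by rewrite l1E.
    have /allP/(_ _ Rra) : all (fun x => x \in l2) ra.
      by apply: sub2 => //; apply/allP.
    by rewrite l2E.
  pose P1 (x : cname * V) := `[< C x.1 x.2 >].
  pose P2 (x : rname * V * V) := `[< D x.1.1 x.1.2 x.2 >].
  exists (@CQ k m (filter P1 l1) (filter P2 l2)).
    apply/List.in_flat_map; exists (filter P1 l1); split=> //.
    by apply/List.in_map_iff; exists (filter P2 l2).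
  exists (filter P1 l1), (filter P2 l2); split=> // [A t|R t t'].
    rewrite mem_filter l1E /P1 /=; split.
      by move=> /andP[/asboolP].
    by move=> [-> ?]; rewrite andbT; apply/asboolP.
  rewrite mem_filter l2E /P2 /=; split.
    by move=> /andP[/asboolP].
  by move=> [-> ?]; rewrite andbT; apply/asboolP.
elim: n => [|n [L [sL HL]]].
  have [L [sL HL]] := step 0.
  exists L; split=> // m C D; rewrite leqn0 => /eqP m0.
  by move: C D; rewrite m0 => C D; exact: HL.
have [L' [sL' HL']] := step n.+1.
exists (L ++ L'); split=> [p /List.in_app_iff[]|m C D]; [exact: sL|exact: sL'|].
rewrite leq_eqVlt => /orP[/eqP mn|mn].
  move: C D; rewrite mn => C D.
  have [p pL' h] := HL' C D; exists p => //.
  by apply/List.in_app_iff; right.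
have [p pL h] := HL m C D mn; exists p => //.
by apply/List.in_app_iff; left.
Qed.

(** * Products *)

(** Over an empty [J] the product would be a single point bearing every name. *)
Lemma interp_of_prod N (J : Type) (M : J -> interp) : inhabited J ->
  (forall j, interp_of N (M j)) -> interp_of N (prod_interp M).
Proof.
move=> [j0] MN; split.
- have ne j : exists u : dom (M j), True.
    by case: (MN j) => -[u _] _ _ _; exists u.
  by exists (fun j => projT1 (cid (ne j))).
- move=> a aN.
  have ex j : exists u, unique (named (M j) a) u by case: (MN j) => _ /(_ a aN).
  exists (fun j => projT1 (cid (ex j))); split=> [j|f fa] /=.
    by case: (cid (ex j)) => /= u [].
  apply: functional_extensionality_dep => j.
  by case: (cid (ex j)) => /= u [_]; apply; apply: fa.
- by move=> a f /(_ j0); case: (MN j0) => _ _ h _ /h.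
- by move=> a b f /(_ j0) fa /(_ j0) fb; case: (MN j0) => _ _ _; apply; eauto.
Qed.

(** A family of matches, one per factor, is the same as a match by tuples. Disjunctions would not
    commute with the product in this way. *)
Lemma cq_sat_prod (J : Type) (M : J -> interp) k (p : cq k) a :
  cq_sat (prod_interp M) p a <-> forall j, cq_sat (M j) p a.
Proof.
split=> [[s [sa sc sr]] j|sat].
  exists (fun t => s t j); split=> [i|A t /sc|R t t' /sr]; last 2 first.
  - exact.
  - exact.
  exact: (sa i j).
exists (fun t j => projT1 (cid (sat j)) t); split=> [i j|A t At j|R t t' Rt j] /=;
  by case: (cid (sat j)) => /= s [sa sc sr]; auto.
Qed.

Lemma ucq_sat1 I k (p : cq k) a : ucq_sat I [:: p] a <-> cq_sat I p a.
Proof. by split=> [[_ [<-|//]]|]; last by exists p => //; left. Qed.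

(** * Canonical queries and matches *)

(** [L] is fixed before [I] and [S], so the canonical queries of infinitely many interpretations
    still fit into one finite disjunction. *)
Lemma canonical_cq_family (Sg : signature) (N : seq iname) n :
  let a (i : 'I_(size N)) := nth 0 N i in
  exists L : seq (cq (size N)), sig_query Sg L /\
    forall (I : interp) (S : set (dom I)), interp_of N I -> S #<= `I_n ->
    exists2 p, List.In p L &
      [/\ cq_sat I p a,
          sig_linked Sg N (sub_interp S) -> rooted p
        & forall I1, cq_sat I1 p a ->
            exists h : dom (sub_interp S) -> dom I1, sig_hom Sg N h].
Proof.
move=> a; have [L [sL HL]] := sig_cq_family Sg (size N) n.
exists L; split=> // I S [_ exN nN injN] Sn.
pose anon u := forall b, b \in N -> ~ named I b u.
have /card_leI_enum[m [e [mn eE]]] : S `&` anon #<= `I_n.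
  by apply: card_le_trans Sn; apply: subset_card_le => u [].
have exa (i : 'I_(size N)) : exists u, named I (a i) u.
  by have [u [? _]] := exN _ (mem_nth 0 (ltn_ord i)); exists u.
have [d dE] := choice exa.
pose v (t : 'I_(size N) + 'I_m) := match t with inl i => d i | inr j => e j end.
have namedv b u : b \in N -> named I b u -> exists2 i, b = a i & v (inl i) = u.
  move=> bN bu; have bs : (index b N < size N)%N by rewrite index_mem.
  have ai : a (Ordinal bs) = b by rewrite /a /= nth_index.
  exists (Ordinal bs) => //=.
  have [w [_ wu]] := exN _ bN.
  by rewrite -(wu u) // -(wu (d (Ordinal bs))) // -{1}ai.
have vS u : S u -> exists t, v t = u.
  move=> Su; have [[b [bN bu]]|h] := pselect (exists b, b \in N /\ named I b u).
    by have [i _ <-] := namedv _ _ bN bu; exists (inl i).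
  have /eE[j <-] : (S `&` anon) u by split=> // b bN bu; apply: h; exists b.
  by exists (inr j).
have [p pL [ca [ra [pE caE raE]]]] := HL m (fun A t => cext I A (v t))
  (fun R t t' => rext I R (v t) (v t')) mn.
exists p => //; rewrite pE; split=> [|linked j|I1 [s [/= sa sc sr]]].
- exists v; split=> [i|A t /caE[]|R t t' /raE[]] //; exact: dE.
- have [Sj anonj] : (S `&` anon) (e j) by apply/eE; exists j.
  have [b [[w Sw] [bN /= bw path]]] := linked (exist _ (e j) Sj) anonj.
  have [i _ iw] := namedv b w bN bw.
  exists i; set E := (X in clos_refl_sym_trans _ X _ _).
  (* The induction ranges over all variables denoting the endpoints; an intermediate element of [S]
     is denoted by some variable by [vS]. *)
  suff H : forall x y : dom (sub_interp S),
      clos_trans _ (@sig_link Sg (sub_interp S)) x y ->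
      forall t t', v t = sval x -> v t' = sval y -> clos_refl_sym_trans _ E t t'.
    exact: (H _ _ path (inl i) (inr j) iw erefl).
  move=> x y; elim=> {x y} [x y xy|x y z _ IH1 _ IH2] t t' tx t'y.
    case: xy => -[R RS /= xy]; [|apply: rst_sym]; apply: rst_step; exists R;
      by apply/raE; split=> //; rewrite tx t'y.
  have [t'' yE] := vS _ (proj2_sig y).
  by apply: rst_trans (IH1 t t'' tx yE) (IH2 t'' t' yE t'y).
- have tS (u : {u | S u}) : exists t, v t = sval u.
    by apply: vS; exact: proj2_sig.
  have [t tE] := choice tS.
  exists (fun u => s (t u)); split=> [A u AS Au|R u w RS Ruw|b u bN bu].
  + by apply: sc; apply/caE; rewrite tE.
  + by apply: sr; apply/raE; rewrite !tE.
  (* Quantified variables denote unnamed elements only, so a named [u] comes from an answer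
     variable, whose name must be [b]. *)
  have := tE u; case: (t u) => [i|j] /= vu.
    have -> : b = a i by apply: injN bu _; rewrite -vu; exact: dE.
    exact: sa.
  have [_ /(_ b bN) []] : (S `&` anon) (e j) by apply/eE; exists j.
  by rewrite vu.
Qed.

Lemma cq_sat_hom (Sg : signature) N (I2 I1 : interp) k (p : cq k) a s
    (h : dom (sub_interp (range s)) -> dom I1) :
  sig_query Sg [:: p] -> (forall i, a i \in N) ->
  [/\ forall i, named I2 (a i) (s (inl i)),
      forall A t, (A, t) \in catoms p -> cext I2 A (s t)
    & forall R t t', (R, t, t') \in ratoms p -> rext I2 R (s t) (s t')] ->
  sig_hom Sg N h -> cq_sat I1 p a.
Proof.
move=> /(_ p (or_introl erefl))[pc pr] aN [sa sc sr] [hc hr hn].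
exists (fun t => h (exist _ (s t) (ex_intro2 _ _ t Logic.I erefl))).
split=> [i|A t At|R t t' Rt].
- by apply: hn => //; exact: sa.
- by apply: hc; [exact: pc At|exact: sc].
- by apply: hr; [exact: pr Rt|exact: sr].
Qed.

Lemma rooted_range_linked (Sg : signature) N (I : interp) k (p : cq k) a
    (s : 'I_k + 'I_(qvars p) -> dom I) :
  sig_query Sg [:: p] -> (forall i, a i \in N) -> rooted p ->
  (forall i, named I (a i) (s (inl i))) ->
  (forall R t t', (R, t, t') \in ratoms p -> rext I R (s t) (s t')) ->
  sig_linked Sg N (sub_interp (range s)).
Proof.
move=> /(_ p (or_introl erefl))[_ pr] aN root sa sr.
pose c t : dom (sub_interp (range s)) :=
  exist _ (s t) (ex_intro2 _ _ t Logic.I erefl).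
(* Both directions are carried along to get through the symmetric closure; the equality stands for
   the empty path, which [clos_trans] lacks. *)
have path t t' : clos_refl_sym_trans _
      (fun t t' => exists R, (R, t, t') \in ratoms p) t t' ->
    [/\ s t = s t' \/ clos_trans _ (@sig_link Sg _) (c t) (c t')
      & s t' = s t \/ clos_trans _ (@sig_link Sg _) (c t') (c t)].
  have cE x y : s x = s y -> c x = c y by move=> h; apply: eq_exist.
  elim=> {t t'} [t t' [R Rt]|t|t t' _ []|t t1 t2 _ [h1 h1'] _ [h2 h2']] //.
  - split; right; apply: t_step; [left|right]; exists R => /=;
      [exact: pr Rt|exact: sr|exact: pr Rt|exact: sr].
  - by split; left.
  - split.
      case: h1 => h1; first by rewrite h1 (cE _ _ h1).
      case: h2 => h2; first by rewrite -h2 -(cE _ _ h2); right.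
      by right; apply: t_trans h1 h2.
    case: h1' => g1; first by rewrite -g1 -(cE _ _ g1).
    case: h2' => g2; first by rewrite g2 (cE _ _ g2); right.
    by right; apply: t_trans g2 g1.
move=> [u us] /= anon; have [[i|j] _ sE] := us.
  by case: (anon (a i)) => //; rewrite -sE; apply: sa.
have [i /path[[ij|ij] _]] := root j.
  by case: (anon (a i)) => //; rewrite -sE -ij; apply: sa.
exists (a i), (c (inl i)); split=> //.
suff -> : exist _ u us = c (inr j) by [].
exact: eq_exist.
Qed.

(** * Forest unravelling *)

Definition utip (I : interp) (w : dom I * seq (rname * dom I)) : dom I :=
  if w.2 is Ru :: _ then Ru.2 else w.1.

(* A node is a root followed by the steps of a path, latest step first; a list
   that is not a path of [I] is just one more root without a name, which costs
   nothing and keeps the domain nonempty when no individual is named. *)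
Definition unravel (I : interp) : interp := {|
  dom := (dom I * seq (rname * dom I))%type;
  named := fun a => [set w | w.2 = [::] /\ named I a w.1];
  cext := fun A => [set w | cext I A (utip w)];
  rext := fun R w => [set w' | rext I R (utip w) (utip w') /\
    ([/\ w.2 = [::], w'.2 = [::], exists a, named I a w.1
       & exists a, named I a w'.1] \/
     w' = (w.1, (R, utip w') :: w.2))]
|}.

(** [utip] is a bisimulation: edges project to edges of [I], and an [R]-successor [v] of the tip is
    reached by prolonging the path with [(R, v)]. *)
Lemma ceval_unravel I C w : ceval (unravel I) C w <-> ceval I C (utip w).
Proof.
elim: C w => [|A|C IH|C IHC D IHD|R C IH] w //=.
- by split=> h /IH.
- by split=> -[/IHC ? /IHD].
split=> [[w' [Rw _] /IH Cw]|[v Rv Cv]]; first by exists (utip w').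
by exists (w.1, (R, v) :: w.2); [split=> //; right|exact/IH].
Qed.

Lemma model_unravel K I : model K I -> model K (unravel I).
Proof.
move=> [[[u0 _] ex nN injN] tb cb rb]; split.
- split.
  + by exists (u0, [::]).
  + move=> a /ex[u [au uu]]; exists (u, [::]); split=> //= -[u' l] /= [-> /uu].
    by move=> ->.
  + by move=> a w [_ /nN].
  + by move=> a b w [_ aw] [_ bw]; apply: injN aw bw.
- by move=> C D CD w /ceval_unravel /(tb _ _ CD) ?; apply/ceval_unravel.
- by move=> A a [u l] Aa /= [-> au]; apply: cb au.
- move=> R a b [u l] [v l'] Rab /= [-> au] [-> bv]; split; first exact: rb Rab au bv.
  by left; split=> //; [exists a|exists b].
Qed.

(** For [X] the image of a match, this is the invariant transported along the atoms of a rooted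
    query. *)
Fixpoint sig_branch (Sg : signature) (I : interp) (X : set (dom (unravel I)))
    (r : dom I) (l : seq (rname * dom I)) : Prop :=
  X (r, l) /\
  match l with
  | [::] => exists a, named I a r
  | (R, u) :: l' =>
    [/\ R \in srn Sg, rext I R (utip (r, l')) u & sig_branch Sg X r l']
  end.

(* In a forest, an undirected path from a root to a node runs through all the
   ancestors of that node, so the roots reach every node of a rooted match by
   directed paths inside the match. *)
Lemma rooted_unravel_connected (Sg : signature) K (I : interp) k (p : cq k) a
    (s : 'I_k + 'I_(qvars p) -> dom (unravel I)) :
  model K I -> sig_query Sg [:: p] -> (forall i, a i \in ind K) -> rooted p ->
  (forall i, named (unravel I) (a i) (s (inl i))) ->
  (forall R t t', (R, t, t') \in ratoms p ->
    rext (unravel I) R (s t) (s t')) ->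
  sig_connected Sg (ind K) (sub_interp (range (fun t => utip (s t)))).
Proof.
move=> [[_ _ nN _] _ _ _] /(_ p (or_introl erefl))[_ pr] aN root sa sr.
pose S := range (fun t => utip (s t)).
rewrite -/S.
pose P t := sig_branch Sg (range s) (s t).1 (s t).2.
have sE t : range s ((s t).1, (s t).2) by exists t => //; case: (s t).
(* An atom joins either two named roots, where [P] holds outright, or a node and its child, whose
   branch extends that of the node by one [Sg]-step. Being an equivalence, the claim survives
   symmetric closure. *)
have Pstep t t' : clos_refl_sym_trans _
      (fun t t' => exists R, (R, t, t') \in ratoms p) t t' -> (P t <-> P t').
  elim=> {t t'} [t t' [R Rt]|t|t t' _ []|t t1 t2 _ h1 _ h2] //; last first.
    exact: iff_trans h1 h2.
  have [/= Rtip [[t0 t0' tn tn']|tt']] := sr _ _ _ Rt.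
    rewrite /P t0 t0' /=; split=> _; split=> //.
      by rewrite -t0'; apply: sE.
    by rewrite -t0; apply: sE.
  rewrite /P tt' /=; split=> [Pt|[_ []]] //.
  split; first by exists t'.
  by split=> //; exact: pr Rt.
have Pi i : P (inl i).
  have [i0 ia] := sa i; rewrite /P i0 /=.
  by split; [rewrite -i0; apply: sE|exists (a i)].
have Pall t : P t.
  by case: t => // j; have [i /Pstep[+ _]] := root j; apply; apply: Pi.
have XS w : range s w -> S (utip w) by move=> [t _ <-]; exists t.
have reach r l : sig_branch Sg (range s) r l -> forall Sl : S (utip (r, l)),
    exists b v, [/\ b \in ind K, named (sub_interp S) b v
      & v = exist _ (utip (r, l)) Sl \/
        clos_trans _ (@sig_step Sg (sub_interp S)) v (exist _ (utip (r, l)) Sl)].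
  elim: l => [|[R u] l IH] /=.
    move=> [_ [b br]] Sr; exists b, (exist _ r Sr).
    by split=> //; [exact: nN br|left].
  move=> [_ [RS Ru branch]] Su.
  have Xl : S (utip (r, l)).
    by apply: XS; move: branch; case: (l) => [[]|[? ?] ? []].
  have [b [v [bK bv path]]] := IH branch Xl.
  exists b, v; split=> //; right.
  have step : @sig_step Sg (sub_interp S) (exist _ (utip (r, l)) Xl)
      (exist _ u Su) by exists R.
  case: path => [->|path]; first exact: t_step.
  by apply: t_trans path _; apply: t_step.
move=> [u us] anon; have [t _ tu] := us.
have Sl : S (utip ((s t).1, (s t).2)) by apply: XS; apply: sE.
have [b [v [bK bv path]]] := reach _ _ (Pall t) Sl.
have uE : exist _ u us = exist _ _ Sl :> dom (sub_interp S).
  by apply: eq_exist; rewrite -tu; case: (s t).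
exists b, v; split=> //; rewrite uE; case: path => // vE.
(* An empty path would make [u] itself named. *)
by case: (anon b bK); rewrite uE -vE.
Qed.

(** * Complete families are nonempty *)

Fixpoint cbound (C : concept) : nat :=
  match C with
  | Top => 0
  | CName A => A.+1
  | Not C => cbound C
  | And C D => maxn (cbound C) (cbound D)
  | Ex _ C => cbound C
  end.

Definition restrict_cnames (b : nat) (I : interp) : interp := {|
  dom := dom I;
  named := named I;
  cext := fun A => [set u | (A < b)%N /\ cext I A u];
  rext := rext I
|}.

Lemma ceval_restrict_cnames b I C u : (cbound C <= b)%N ->
  ceval (restrict_cnames b I) C u <-> ceval I C u.
Proof.
elim: C u => [|A|C IH|C IHC D IHD|R C IH] u //= Cb.
- by split=> [[]|].
- by split=> h /(IH _ Cb).
- move: Cb; rewrite geq_max => /andP[Cb Db].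
  by split=> -[/(IHC _ Cb) ? /(IHD _ Db)].
- by split=> -[v Rv /(IH _ Cb)]; exists v.
Qed.

(** Take [b] above all concept names of the TBox and the ABox: emptying the names from [b] on then
    changes nothing that [K] speaks about. *)
Lemma model_restrict_cnames K : exists b, forall I,
  model K I -> model K (restrict_cnames b I).
Proof.
have [bt btP] : exists b, forall C D, List.In (C, D) (tbox K) ->
    (cbound C <= b)%N /\ (cbound D <= b)%N.
  elim: (tbox K) => [|[C0 D0] l [b IH]]; first by exists 0.
  exists (maxn (maxn (cbound C0) (cbound D0)) b) => C D; rewrite !leq_max.
  move=> [[-> ->]|/IH[-> ->]]; by rewrite ?leqnn ?orbT.
exists (maxn bt (\max_(x <- cabox K) x.1.+1)) => I [iI tb cb rb].
split=> // [C D CD u|A a u Aa au].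
  have [Cb Db] := btP _ _ CD.
  move=> /ceval_restrict_cnames h; apply/ceval_restrict_cnames.
    by rewrite leq_max Db.
  by apply: (tb _ _ CD); apply: h; rewrite leq_max Cb.
split; last exact: cb au.
rewrite leq_max; apply/orP; right.
exact: (@leq_bigmax_seq _ _ xpredT (fun x : cname * iname => x.1.+1) (A, a)).
Qed.

(* Over an empty family completeness would make K entail a query about a
   concept name foreign to K. *)
Lemma complete_inhabited K (J : Type) (M : J -> interp) :
  consistent K -> complete K M -> inhabited J.
Proof.
move=> [I mI] [_ compl]; apply: contrapT => noJ.
have [b bP] := model_restrict_cnames K.
(* The Boolean query for some element of the concept name [b], which the restricted model leaves
   empty. *)
pose p : cq 0 := @CQ 0 1 [:: (b, inr ord0)] [::].
pose a (i : 'I_0) : iname := 0.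
have a0 i : a i \in ind K by case: i.
have [_ ent] := compl 0 [:: p] a erefl a0.
have /ucq_sat1[s [_ sc _]] : ucq_sat (restrict_cnames b I) [:: p] a.
  by apply: ent; [move=> j; case: noJ|exact: bP].
by have [] := sc _ _ (mem_head _ _); rewrite ltnn.
Qed.

(** * Bookkeeping for UCQs *)

Lemma sig_query_single Sg k (q : ucq k) p :
  sig_query Sg q -> List.In p q -> sig_query Sg [:: p].
Proof. by move=> sq pq _ [<-|//]; apply: sq. Qed.

(** Supplies the [n] at which embeddability is applied: the image of a match has no more elements
    than its disjunct has variables. *)
Lemma ucq_size_bound k (q : ucq k) : exists2 n, (0 < n)%N &
  forall p, List.In p q -> (#|{: 'I_k + 'I_(qvars p)}| <= n)%N.
Proof.
elim: q => [|p q [n n0 IH]]; first by exists 1%N.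
exists (maxn #|{: 'I_k + 'I_(qvars p)}| n); first by rewrite leq_max n0 orbT.
by move=> p' /= [<-|/IH h]; rewrite leq_max ?leqnn ?h ?orbT.
Qed.

Lemma ucq_filter k (L : seq (cq k)) (P : cq k -> Prop) :
  exists L', forall p, List.In p L' <-> List.In p L /\ P p.
Proof.
exists (List.filter (fun p => `[< P p >]) L) => p; rewrite List.filter_In.
by split=> -[pL /asboolP].
Qed.

Lemma ucq_size_gt0 k (q : ucq k) p : List.In p q -> (0 < size q)%N.
Proof. by case: q. Qed.

(** * The four equivalences for complete families *)

Section Families.
Variables (K1 K2 : kb) (Sg : signature) (J1 J2 : Type).
Variables (M1 : J1 -> interp) (M2 : J2 -> interp).
Hypotheses (consK1 : consistent K1) (consK2 : consistent K2).
Hypotheses (complM1 : complete K1 M1) (complM2 : complete K2 M2).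

Let interp1 j : interp_of (ind K1) (M1 j).
Proof. by case: complM1 => /(_ j)[]. Qed.

Let interp2 j : interp_of (ind K2) (M2 j).
Proof. by case: complM2 => /(_ j)[]. Qed.

(** Completeness of [M1] lifts satisfaction to [K1]. That the answers lie in [ind K1] is read off a
    match in any one member of [M1], since it names nothing else. *)
Lemma sig_entails_of_sat (Q : query_class) :
  (forall k (q : ucq k), Q k q -> UCQ q) ->
  (forall k (q : ucq k) a, Q k q -> sig_query Sg q ->
    (forall i, a i \in ind K2) -> kb_entails K2 q a ->
    forall j1, ucq_sat (M1 j1) q a) ->
  sig_entails Sg Q K1 K2.
Proof.
move=> QU sat k q a Qq sq a2 ent; have {}sat := sat k q a Qq sq a2 ent.
have [j0] := complete_inhabited consK1 complM1.
have a1 i : a i \in ind K1.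
  have [p _ [s [/(_ i) sa _ _]]] := sat j0.
  by have [_ _ + _] := interp1 j0; apply; exact: sa.
by split=> //; have [_ /(_ k q a (QU _ _ Qq) a1)[_]] := complM1; apply.
Qed.

(* The UCQ witnessing non-entailment collects the canonical queries that
   fail in the fixed model [M1 j1]. *)
Lemma family_embedding_of_entails (Q : query_class)
    (conn : interp -> Prop) (Pq : forall k, cq k -> Prop) n j1 :
  (forall k (q : ucq k), UCQ q -> (forall p, List.In p q -> Pq k p) -> Q k q) ->
  (forall I k (p : cq k), conn I ->
    (sig_linked Sg (ind K2) I -> rooted p) -> Pq k p) ->
  sig_entails Sg Q K1 K2 ->
  exists j2, forall S : set (dom (M2 j2)), S #<= `I_n ->
    conn (sub_interp S) ->
    exists h : dom (sub_interp S) -> dom (M1 j1), sig_hom Sg (ind K2) h.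
Proof.
move=> QP connP ent; apply: contrapT => no.
have bad j2 : exists S : set (dom (M2 j2)), [/\ S #<= `I_n,
    conn (sub_interp S)
  & ~ exists h : dom (sub_interp S) -> dom (M1 j1), sig_hom Sg (ind K2) h].
  apply: contrapT => ok; apply: no; exists j2 => S Sn cS.
  by apply: contrapT => nh; apply: ok; exists S.
have [L [sL LP]] := canonical_cq_family Sg (ind K2) n.
pose a (i : 'I_(size (ind K2))) := nth 0 (ind K2) i.
have aK2 i : a i \in ind K2 by apply: mem_nth.
have [q qE] := ucq_filter L (fun p => Pq _ p /\ ~ cq_sat (M1 j1) p a).
have sat j2 : exists2 p, List.In p q & cq_sat (M2 j2) p a.
  have [S [Sn cS nh]] := bad j2.
  have [p pL [psat proot phom]] := LP _ S (interp2 j2) Sn.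
  exists p => //; apply/qE; split=> //; split; last by move=> /phom.
  exact: connP cS proot.
(* One member of [M2] suffices to see that [q] has a disjunct, as [UCQ] demands. *)
have [j0] := complete_inhabited consK2 complM2.
have Uq : UCQ q by have [p /ucq_size_gt0] := sat j0.
have [||||_ K1q] := ent _ q a.
- by apply: QP => // p /qE[_ []].
- by move=> p /qE[/sL].
- exact: aK2.
- by have [_ /(_ _ q a Uq aK2)[_]] := complM2; apply.
by have [p /qE[_ [_ np]] //] := K1q (M1 j1) (complM1.1 j1).
Qed.

(** The canonical query of [S] passes from the product of [M2] to its factors, by completeness to
    [K2], by entailment to [K1], hence to all [M1 j1] and to their product. *)
Lemma prod_embedding_of_entails (Q : query_class) n
    (S : set (dom (prod_interp M2))) :
  (forall k (p : cq k), (sig_linked Sg (ind K2) (sub_interp S) -> rooted p) ->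
    Q k [:: p]) ->
  sig_entails Sg Q K1 K2 -> S #<= `I_n ->
  exists h : dom (sub_interp S) -> dom (prod_interp M1), sig_hom Sg (ind K2) h.
Proof.
move=> QP ent Sn; have [L [sL LP]] := canonical_cq_family Sg (ind K2) n.
have iP := interp_of_prod (complete_inhabited consK2 complM2) interp2.
have [p pL [psat proot phom]] := LP _ S iP Sn.
have aK2 (i : 'I_(size (ind K2))) : nth 0 (ind K2) i \in ind K2.
  exact: mem_nth.
apply: phom; apply/cq_sat_prod => j1.
have [||_ K1p] := ent _ [:: p] _ (QP _ _ proot) _ aK2.
- exact: sig_query_single pL.
- have [_ compl] := complM2; apply/(compl _ [:: p]) => // j2.
  by apply/ucq_sat1; move: j2; apply/cq_sat_prod.
by apply/ucq_sat1; apply: K1p; exact: complM1.1.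
Qed.

(** Embeddings are asked for images of variables only, with linkedness granted when [p] is rooted;
    this form serves arbitrary and rooted CQs alike. *)
Lemma prod_sat_of_embedding k (p : cq k) a :
  sig_query Sg [:: p] -> (forall i, a i \in ind K2) ->
  kb_entails K2 [:: p] a ->
  (forall n, (0 < n)%N -> forall s : 'I_k + 'I_(qvars p) -> dom (prod_interp M2),
    range s #<= `I_n ->
    (rooted p -> sig_linked Sg (ind K2) (sub_interp (range s))) ->
    exists h : dom (sub_interp (range s)) -> dom (prod_interp M1),
      sig_hom Sg (ind K2) h) ->
  forall j1, ucq_sat (M1 j1) [:: p] a.
Proof.
move=> sp aK2 ent emb j1; apply/ucq_sat1; move: j1; apply/cq_sat_prod.
have [s [sa sc sr]] : cq_sat (prod_interp M2) p a.
  by apply/cq_sat_prod => j2; apply/ucq_sat1/ent; exact: complM2.1.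
have [n n0 /(_ p (or_introl erefl)) np] := ucq_size_bound [:: p].
have [h hh] : exists h : dom (sub_interp (range s)) -> dom (prod_interp M1),
    sig_hom Sg (ind K2) h.
  apply: (emb n n0); first exact: card_range_leI.
  by move=> root; apply: rooted_range_linked sa sr.
exact: cq_sat_hom hh.
Qed.

Lemma UCQ_entails_embeddable :
  sig_entails Sg UCQ K1 K2 <->
    forall n, (0 < n)%N -> forall j1, exists j2,
      embeddable n Sg (ind K2) (M2 j2) (M1 j1).
Proof.
split=> [ent n n0 j1|emb].
  have [|||j2 H] := @family_embedding_of_entails UCQ (fun=> True)
    (fun _ _ => True) n j1; rewrite //.
  by exists j2 => S Sn; apply: H.
apply: sig_entails_of_sat => // k q a _ sq aK2 ent j1.
have [n n0 qn] := ucq_size_bound q.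
have [j2 emb2] := emb n n0 j1.
have [p pq [s sP]] := ent _ (complM2.1 j2).
have [h hh] := emb2 (range s) (card_range_leI s (qn p pq)).
by exists p => //; apply: cq_sat_hom hh => //; exact: sig_query_single pq.
Qed.

(* Rootedness ignores the direction of roles, connectedness does not: the match
   is therefore taken in the unravelling of [M2 j2], which is again a model of
   K2, and projected back. *)
Lemma rUCQ_entails_con_embeddable :
  sig_entails Sg rUCQ K1 K2 <->
    forall n, (0 < n)%N -> forall j1, exists j2,
      con_embeddable n Sg (ind K2) (M2 j2) (M1 j1).
Proof.
split=> [ent n n0 j1|emb].
  apply: (@family_embedding_of_entails rUCQ (sig_connected Sg (ind K2))
    rooted) => // I k p con; apply=> u anon.
  (* A directed path is in particular an undirected one, so the canonical query of a connected set
     is rooted. *)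
  have [b [v [bN bv path]]] := con u anon; exists b, v; split=> //.
  elim: path => [x y xy|x y z _ IH1 _ IH2]; first by apply: t_step; left.
  exact: t_trans IH1 IH2.
apply: sig_entails_of_sat => [k q []//|k q a [_ rq] sq aK2 ent j1].
have [n n0 qn] := ucq_size_bound q.
have [j2 emb2] := emb n n0 j1.
have mI := complM2.1 j2.
have [p pq [s [sa sc sr]]] := ent _ (model_unravel mI).
have sp := sig_query_single sq pq.
have [h hh] := emb2 (range (fun t => utip (s t))) (card_range_leI _ (qn p pq))
  (rooted_unravel_connected mI sp aK2 (rq p pq) sa sr).
exists p => //; apply: cq_sat_hom hh => //; split=> [i|A t /sc|R t t' /sr[]] //.
(* Answer variables are matched to roots, which the projection leaves in place. *)
by rewrite /utip; have [-> ] := sa i.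
Qed.

Lemma CQ_entails_prod_embeddable :
  sig_entails Sg CQs K1 K2 <->
    forall n, (0 < n)%N ->
      embeddable n Sg (ind K2) (prod_interp M2) (prod_interp M1).
Proof.
split=> [ent n n0 S Sn|emb]; first exact: (prod_embedding_of_entails _ ent Sn).
apply: sig_entails_of_sat => [k q sz|k q a]; last first.
  case: q => [|p []] // _ sq aK2 ent.
  by apply: prod_sat_of_embedding => // n n0 s sn _; apply: emb sn.
by rewrite /UCQ sz.
Qed.

(** Rootedness and linkedness both ignore the direction of roles, so [rooted_range_linked] applies
    to the match in the product itself. *)
Lemma rCQ_entails_prod_link_embeddable :
  sig_entails Sg rCQs K1 K2 <->
    forall n, (0 < n)%N ->
      link_embeddable n Sg (ind K2) (prod_interp M2) (prod_interp M1).
Proof.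
split=> [ent n n0 S Sn lS|emb].
  apply: (prod_embedding_of_entails _ ent Sn) => k p /(_ lS) rp.
  by split=> // _ [<-|//].
apply: sig_entails_of_sat => [k q [sz _]|k q a [sz rq]]; last first.
  case: q sz rq => [|p []] // _ rq sq aK2 ent.
  apply: prod_sat_of_embedding => // n n0 s sn lS; apply: emb sn _ => //.
  by apply/lS/rq; left.
by rewrite /UCQ sz.
Qed.

End Families.

Theorem theorem2 (K1 K2 : kb) (Sg : signature)
    (J1 J2 : Type) (M1 : J1 -> interp) (M2 : J2 -> interp)
    (consK1 : consistent K1) (consK2 : consistent K2)
    (complM1 : complete K1 M1) (complM2 : complete K2 M2) :
  (sig_entails Sg UCQ K1 K2 <->
    forall n, (0 < n)%N -> forall j1, exists j2,
      embeddable n Sg (ind K2) (M2 j2) (M1 j1)) /\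
  (sig_entails Sg rUCQ K1 K2 <->
    forall n, (0 < n)%N -> forall j1, exists j2,
      con_embeddable n Sg (ind K2) (M2 j2) (M1 j1)) /\
  (sig_entails Sg CQs K1 K2 <->
    forall n, (0 < n)%N ->
      embeddable n Sg (ind K2) (prod_interp M2) (prod_interp M1)) /\
  (sig_entails Sg rCQs K1 K2 <->
    forall n, (0 < n)%N ->
      link_embeddable n Sg (ind K2) (prod_interp M2) (prod_interp M1)).
Proof.
split; first exact: UCQ_entails_embeddable.
split; first exact: rUCQ_entails_con_embeddable.
split; first exact: CQ_entails_prod_embeddable.
exact: rCQ_entails_prod_link_embeddable.
Qed.
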